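(* Let $G$ be a tree with $n$ vertices. Then the degree of the toric ideal $I_G$ can be calculated by the formula $$\deg(I_G)=\frac12\sum_{e\in E(G)}\deg(I_{G\setminus e}),$$ where the notation $G\setminus e$ denotes the graph $G$ with the edge $e$ removed.
   Context: For a graph $G$ with vertex set $[n]=\{1,\dots,n\}$, edge set $E(G)$ and set of isolated vertices $Iso(G)$, $I_G$ is the kernel of the $\mathbb{C}$-algebra homomorphism $$\phi_G:\mathbb{C}[p_{i_1\cdots i_n}\mid i_j\in\{0,1\}]\to \mathbb{C}[t^{(j,k)}_{a,b},\,t^{(l)}_{a}\mid \{j,k\}\in E(G),\ l\in Iso(G),\ a,b\in\{0,1\}],$$ $$p_{i_1\cdots i_n}\mapsto \prod_{\{j,k\}\in E(G)}t^{(j,k)}_{i_j,i_k}\prod_{l\in Iso(G)}t^{(l)}_{i_l};$$ it is a toric ideal, homogeneous in the standard grading. $\deg(I_G)$ is the degree of the projective toric variety defined by $I_G$. Removing an edge from a graph keeps all of its vertices.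
   Formalization: The tree is assumed to have at least two vertices, since for n = 1 the ideal is zero with degree 1 while the sum over edges is empty and equals 0. *)

(* Defs.v *)
From mathcomp Require Import all_boot all_order all_algebra.
From mathcomp Require Import boolp classical_sets reals complex.
From mathcomp Require Import mpoly.

Set Implicit Arguments.
Unset Strict Implicit.
Unset Printing Implicit Defensive.

Import GRing.Theory.
Local Open Scope ring_scope.

Record sgraph (n : nat) := SGraph {
  adj :> rel 'I_n;
  adj_sym : ssrbool.symmetric adj;
  adj_irr : irreflexive adj
}.

(* The edge {j, k} is represented by the pair (j, k) with j < k. *)
Definition edges n (G : sgraph n) : {set 'I_n * 'I_n} :=
  [set e : 'I_n * 'I_n | (e.1 < e.2)%N && G e.1 e.2].

Definition isolated n (G : sgraph n) : {set 'I_n} :=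
  [set l | [forall k, ~~ G l k]].

Section DelEdge.
Variables (n : nat) (G : sgraph n) (e : 'I_n * 'I_n).

Definition del_adj : rel 'I_n :=
  [rel j k | [&& G j k, (j, k) != e & (k, j) != e]].

Lemma del_adj_sym : ssrbool.symmetric del_adj.
Proof. by move=> j k; rewrite /del_adj /= (adj_sym G j k) (andbC ((j, k) != e)). Qed.

Lemma del_adj_irr : irreflexive del_adj.
Proof. by move=> j; rewrite /del_adj /= adj_irr. Qed.

Definition del_edge : sgraph n := SGraph del_adj_sym del_adj_irr.
End DelEdge.

Definition is_connected n (G : sgraph n) : Prop :=
  (0 < n)%N /\ forall x y : 'I_n, connect G x y.

(* [ucycle] also accepts sequences of size at most 2, e.g. both orientations of
   a single edge; a graph cycle has at least three vertices. *)
Definition is_acyclic n (G : sgraph n) : Prop :=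
  forall c : seq 'I_n, (2 < size c)%N -> ~ ucycle G c.

Definition is_tree n (G : sgraph n) : Prop := is_connected G /\ is_acyclic G.

Section ToricIdeal.
Variables (F : fieldType) (n : nat) (G : sgraph n).

Notation state := {ffun 'I_n -> bool}.

(* [inl (e, (a, b))] is t^e_{a,b} and [inr (l, a)] is t^(l)_a. *)
Definition param : finType :=
  ({e : 'I_n * 'I_n | e \in edges G} * (bool * bool)
   + {l : 'I_n | l \in isolated G} * bool)%type.

(* The indeterminates of {mpoly F[N]} are indexed by 'I_N, so those indexed by a
   finite type T are numbered through [enum_rank] and [enum_val], N = #|T|. *)
Definition tvar (x : param) : {mpoly F[#|param|]} := 'X_(enum_rank x).

Definition phi_var (s : state) : {mpoly F[#|param|]} :=
  (\prod_(e : {e : 'I_n * 'I_n | e \in edges G})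
      tvar (inl (e, (s (val e).1, s (val e).2))))
  * \prod_(l : {l : 'I_n | l \in isolated G}) tvar (inr (l, s (val l))).

Definition phi (p : {mpoly F[#|state|]}) : {mpoly F[#|param|]} :=
  p \mPo [tuple phi_var (enum_val i) | i < #|state|].

Definition toric_ideal : set {mpoly F[#|state|]} := [set p | phi p = 0]%classic.
End ToricIdeal.

Arguments toric_ideal F {n} G.

Section Degree.
Variables (F : fieldType) (N : nat) (I : set {mpoly F[N]}).

(* The classes of b_0, ..., b_(h-1) form a basis of (S/I)_d, S = {mpoly F[N]}. *)
Definition is_quotient_basis (d h : nat) (b : 'I_h -> {mpoly F[N]}) : Prop :=
  [/\ forall i, b i \is d.-homog,
      forall c : 'I_h -> F, I (\sum_i c i *: b i) -> forall i, c i = 0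
    & forall p : {mpoly F[N]}, p \is d.-homog ->
        exists c : 'I_h -> F, I (p - \sum_i c i *: b i)].

Definition hilbert_fun_is (d h : nat) : Prop :=
  exists b : 'I_h -> {mpoly F[N]}, is_quotient_basis d b.

Definition is_hilbert_poly (P : {poly rat}) : Prop :=
  exists d0 : nat, forall d : nat, (d0 <= d)%N ->
    exists2 h : nat, hilbert_fun_is d h & P.[d%:R] = h%:R.

(* Every homogeneous ideal has exactly one Hilbert polynomial; the default value
   0 of [xget] is relevant only for sets I that are not such ideals. *)
Definition hilbert_poly : {poly rat} :=
  xget 0 [set P | is_hilbert_poly P]%classic.

(* The degree of the projective scheme defined by I: r! times the leading
   coefficient of its Hilbert polynomial, where r = (size hilbert_poly).-1 is the
   degree of that polynomial, i.e. the dimension of the scheme. *)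
Definition ideal_degree : rat :=
  lead_coef hilbert_poly * ((size hilbert_poly).-1)`!%:R.
End Degree.

(* Main.v *)
Require Import Defs.
From mathcomp Require Import all_boot all_order all_algebra.
From mathcomp Require Import boolp reals complex.
From mathcomp Require classical_sets.
From mathcomp Require Import zify ring lra.
From mathcomp Require Import mpoly.

Set Implicit Arguments.
Unset Strict Implicit.
Unset Printing Implicit Defensive.

Import Order.TTheory GRing.Theory Num.Theory.
Local Open Scope ring_scope.

(** For an edge [{j, k}], the monomial [phi(p_(s_1) ... p_(s_d))] records the
    2 x 2 table counting the states [s_i] with given values at [j] and [k].
    Hence the Hilbert function of [I_G] at [d] is the number of families of
    2 x 2 tables with total [d], one for each edge, together with the number of
    states with value [true] at each isolated vertex, arising from [d] states.
    On a forest the only constraint is that tables meeting at a vertex have the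
    same margin there, as states can be glued leaf by leaf
    ([acyclic_sets_exist]).  A table with total [d] and margins [a], [b] is
    determined by one corner entry, which ranges over an interval of size
    [k_d(a, b) = num_tables d a b], and so the Hilbert function is
    [Z_E(d) = sum_(m in [0, d]^n) prod_({j, k} in E) k_d(m_j, m_k)]
    with [E] the edge set ([hilbert_fun_toric]).

    [Z_E] is a polynomial when [E] is a forest ([table_sum_poly]).  To sum out
    a leaf means to apply [g |-> sum_i k_d(-, i) g(i)], which sends functions
    polynomial in [d] and [m] to such functions because
    [k_d(m, i) = 1 - m + min(m, i) + min(m, d - i)] ([poly2_tables]).
    The degree of [Z_E] is [r = n + #|E|], because [Z_E(d) <= (d+1)^r] and
    [q^r <= Z_E(3q)].  So the degree of [I_G] is [r!] times the leading
    coefficient of [Z_E].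

    The formula comes from a shift of the tables.  With total [d+2] and margins
    [a+1], [b+1], all tables but one have both diagonal entries positive, and
    subtracting one from these entries leads to total [d] and margins [a], [b]:
    [k_(d+2)(a+1, b+1) - 1 = k_d(a, b)].  On the other hand,
    [k_(d+2)(a, b) = 1] if [a] or [b] is [0] or [d+2].  As every vertex of a
    tree with at least two vertices lies on an edge, replacing each factor [k] by
    [k - 1] in [Z_E(d+2)] gives exactly [Z_E(d)] ([table_sum_shift]), and
    expanding the product yields
    [Z_E(d) = sum_(S subset E) (-1)^#|S| Z_(E \ S)(d+2)].
    The terms with [#|S| >= 2] have degree at most [r - 2].  Comparing the
    coefficients of [d^(r-1)] in
    [Z_E(d+2) - Z_E(d) = sum_(e in E) Z_(E \ e)(d+2) + O(d^(r-2))]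
    gives [2 r lc(Z_E) = sum_(e in E) lc(Z_(E \ e))], which after
    multiplication by [(r-1)!] is twice the theorem. *)

(** * Forests are built leaf by leaf *)

(** An end of a longest path inside [U] is a leaf of [U]: its neighbours in [U]
    lie on the path by maximality, and a neighbour other than the next vertex
    would close a cycle. *)
Lemma acyclic_leaf n (G : sgraph n) (U : {set 'I_n}) :
  is_acyclic G -> U != set0 ->
  exists2 v, v \in U & {in U &, forall u w, G v u -> G v w -> u = w}.
Proof.
move=> acyc /set0Pn [x0 x0U].
pose Q k := `[< exists s : seq 'I_n,
  [/\ size s = k, uniq s, all (mem U) s & sorted G s] >].
have Q1 : Q 1%N by apply/asboolP; exists [:: x0]; rewrite /= x0U.
have Qn k : Q k -> (k <= n)%N.
  case/asboolP=> s [<- us _ _].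
  by rewrite -[leqRHS]card_ord cardE; apply: uniq_leq_size => // y _; rewrite mem_enum.
have [k /asboolP [s [sz us Us ps]] kmax] := ex_maxnP (ex_intro _ 1%N Q1) Qn.
have := kmax _ Q1; rewrite -{}sz in kmax *.
case: s us Us ps kmax => //= x p us /andP [xU Up] px kmax _.
exists x => //.
suff nxt u : u \in U -> G x u -> u = head x p.
  by move=> u w uU wU xu xw; rewrite (nxt u) // (nxt w).
move=> uU xu; case: (boolP (u \in x :: p)) => [|upn]; last first.
  have : Q (size p).+2.
    apply/asboolP; exists (u :: x :: p).
    by rewrite /= (adj_sym G u x) xu uU xU Up px us upn.
  by move/kmax; rewrite ltnn.
rewrite inE => /predU1P [ux|up]; first by rewrite ux adj_irr in xu.
move: us px; case/splitPr: up => -[|y p1] p2 //= us px.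
case: (acyc (x :: y :: p1 ++ [:: u])); first by rewrite /= size_cat addn1.
apply/andP; split.
  rewrite /= rcons_cat cat_path /= (adj_sym G u x) xu andbT.
  by move: px; rewrite cat_path /= => /and4P [-> -> -> _].
apply: (@subseq_uniq _ _ (x :: y :: p1 ++ u :: p2)) us; rewrite /= !eqxx.
by rewrite cats1 -cat_rcons prefix_subseq.
Qed.

Lemma acyclic_ind n (G : sgraph n) (P : {set 'I_n} -> Prop) :
  is_acyclic G -> P set0 ->
  (forall (U : {set 'I_n}) v, v \notin U ->
     {in U &, forall u w, G v u -> G v w -> u = w} -> P U -> P (v |: U)) ->
  P setT.
Proof.
move=> acyc P0 PS; suff: forall k (U : {set 'I_n}), #|U| = k -> P U by apply.
elim=> [|k IHk] U cU; first by rewrite (cards0_eq cU).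
have [|v vU leafv] := @acyclic_leaf _ G U acyc; first by rewrite -card_gt0 cU.
rewrite -(setD1K vU); apply: PS; first by rewrite !inE eqxx.
  by move=> u w /setD1P [_ uU] /setD1P [_ wU]; apply: leafv.
by apply: IHk; move: cU; rewrite (cardsD1 v) vU => -[].
Qed.

(** * Hilbert functions of kernels of monomial maps *)

Section MonomialMap.
Variables (F : fieldType) (N M : nat).
Variable f : {linear {mpoly F[N]} -> {mpoly F[M]}}.

Let I : classical_sets.set {mpoly F[N]} := fun p => f p = 0.

(** The matrices expressing either basis in the other have product [1], which
    bounds the number of rows by the number of columns. *)
Lemma hilbert_fun_le d h h' :
  hilbert_fun_is I d h -> hilbert_fun_is I d h' -> (h <= h')%N.
Proof.
move=> [b [bh bfree bgen]] [b' [bh' _ bgen']].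
have [c cP] := choice (fun i => bgen' _ (bh i)).
have [c' cP'] := choice (fun j => bgen _ (bh' j)).
pose C := \matrix_(i, j) c i j; pose C' := \matrix_(j, i) c' j i.
suff: C *m C' = 1%:M by apply: mulmx1_min.
apply/matrixP=> i k; rewrite !mxE.
have fb : f (b i) = \sum_j c i j *: f (b' j).
  by have := cP i; rewrite /I linearB linear_sum => /eqP; rewrite subr_eq0 => /eqP ->;
     apply: eq_bigr => j _; rewrite linearZ.
have fb' j : f (b' j) = \sum_l c' j l *: f (b l).
  by have := cP' j; rewrite /I linearB linear_sum => /eqP; rewrite subr_eq0 => /eqP ->;
     apply: eq_bigr => l _; rewrite linearZ.
apply/eqP; rewrite -subr_eq0; apply/eqP.
under eq_bigr do rewrite !mxE.
apply: (bfree (fun l => \sum_j c i j * c' j l - (i == l)%:R)).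
rewrite /I linear_sum.
under eq_bigr do rewrite linearZ /= scalerBl.
rewrite sumrB [X in _ - X](bigD1 i) //= eqxx scale1r [X in _ - (_ + X)]big1.
  rewrite addr0 fb; apply/eqP; rewrite subr_eq0; apply/eqP.
  under eq_bigr do rewrite scaler_suml.
  rewrite exchange_big; apply: eq_bigr => j _; rewrite fb' scaler_sumr.
  by apply: eq_bigr => l _; rewrite scalerA.
by move=> l /negbTE; rewrite eq_sym => ->; rewrite scale0r.
Qed.

Lemma hilbert_fun_inj d h h' :
  hilbert_fun_is I d h -> hilbert_fun_is I d h' -> h = h'.
Proof. by move=> H H'; apply/eqP; rewrite eqn_leq !(@hilbert_fun_le d). Qed.

Variable psi : 'X_{1..N} -> 'X_{1..M}.
Hypothesis fX : forall m, f 'X_[m] = 'X_[psi m].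

(** The quotient by the kernel is spanned by the distinct images of the
    monomials.  They are counted through any finite invariant [st] that separates
    the same monomials of degree [d] as [psi]. *)
Lemma hilbert_fun_card (T : finType) (A : {set T}) (st : 'X_{1..N} -> T) d :
  (forall m m', mdeg m = d -> mdeg m' = d -> psi m = psi m' <-> st m = st m') ->
  (forall m, mdeg m = d -> st m \in A) ->
  (forall t, t \in A -> exists2 m, mdeg m = d & st m = t) ->
  hilbert_fun_is I d #|A|.
Proof.
move=> psi_st stA stS.
have sec (i : 'I_#|A|) : exists m, mdeg m = d /\ st m = enum_val i.
  by have [m md ms] := stS _ (enum_valP i); exists m.
have [s sP] := choice sec.
have sd i := (sP i).1; have ss i := (sP i).2.
have psis i j : psi (s i) = psi (s j) -> i = j.
  by move/(psi_st _ _ (sd i) (sd j)); rewrite !ss => /enum_val_inj.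
exists (fun i => 'X_[s i]); split.
- by move=> i; rewrite dhomogX /= sd.
- move=> c; rewrite /I linear_sum => fc i.
  have := congr1 (mcoeff (psi (s i))) fc.
  rewrite raddf_sum mcoeff0 /= (bigD1 i) //= big1 => [|j ji].
    by rewrite addr0 linearZ /= mcoeffZ fX mcoeffX eqxx mulr1.
  rewrite linearZ /= mcoeffZ fX mcoeffX; case: eqP => [/psis ij|_]; last by rewrite mulr0.
  by rewrite ij eqxx in ji.
- move=> p /dhomogP p_hom.
  exists (fun i => \sum_(m <- msupp p | st m == enum_val i) p@_m).
  rewrite /I linearB linear_sum [in X in X - _](mpolyE p) linear_sum /=.
  apply/eqP; rewrite subr_eq0; apply/eqP.
  under [RHS]eq_bigr do rewrite linearZ /= fX scaler_suml.
  rewrite [RHS](exchange_big_dep predT) //= big_seq [RHS]big_seq.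
  apply: eq_bigr => m /p_hom md; rewrite linearZ /= fX.
  have mA := stA _ md; rewrite (big_pred1 (enum_rank_in mA (st m))); last first.
    move=> i; apply/eqP/eqP => [smi|->]; last by rewrite enum_rankK_in.
    by apply: enum_val_inj; rewrite enum_rankK_in.
  congr (_ *: 'X_[_]); apply/psi_st => //.
  by rewrite ss enum_rankK_in.
Qed.
End MonomialMap.

(** * Counting compatible families of tables *)

(** The number of 2 x 2 tables of naturals with total [d], second row sum [a] and
    second column sum [b] (for [a, b <= d]): the last corner entry ranges over
    the interval from [a + b - d] to [minn a b]. *)
Definition num_tables (d a b : nat) : nat := ((minn a b).+1 - (a + b - d))%N.

Definition table_sum n (E : {set 'I_n * 'I_n}) (d : nat) : nat :=
  (\sum_(m : {ffun 'I_n -> 'I_d.+1}) \prod_(e in E) num_tables d (m e.1) (m e.2))%N.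

Definition corner_choices n (E : {set 'I_n * 'I_n}) d (m : {ffun 'I_n -> 'I_d.+1}) :=
  pfamily (ord0 : 'I_d.+1) (mem E)
    (fun e => [pred x : 'I_d.+1 | m e.1 + m e.2 - d <= x <= minn (m e.1) (m e.2)]%N).

(** The pairs [(m, x)] of vertex margins and corner entries that encode the
    compatible families of tables on the edges [E]; [x] is [0] off [E], so that
    each family is encoded once. *)
Definition table_families n (E : {set 'I_n * 'I_n}) (d : nat) :
    {set {ffun 'I_n -> 'I_d.+1} * {ffun 'I_n * 'I_n -> 'I_d.+1}} :=
  [set t | t.2 \in corner_choices E t.1].

Lemma card_ord_itv d lo hi :
  (hi <= d)%N -> #|[pred x : 'I_d.+1 | (lo <= x <= hi)%N]| = (hi.+1 - lo)%N.
Proof.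
move=> hid; rewrite -sum1_card -[RHS]muln1 -sum_nat_const_nat big_geq_mkord.
rewrite (big_ord_widen_cond d.+1 (fun i => lo <= i)%N (fun=> 1%N)) //=.
Qed.

Lemma card_table_families n (E : {set 'I_n * 'I_n}) d : #|table_families E d| = table_sum E d.
Proof.
rewrite -sum1_card (eq_bigl _ _ (in_set _)).
rewrite -(pair_big_dep predT (fun m x => x \in corner_choices E m) (fun _ _ => 1%N)) /=.
apply: eq_bigr => m _; rewrite sum1_card card_pfamily foldrE big_map -big_enum.
apply: eq_big => [e|e _]; first by [].
by rewrite card_ord_itv // geq_min -ltnS ltn_ord.
Qed.

(** * Gluing the tables along a forest *)

Lemma exists_subset_card (T : finType) (A : {set T}) k :
  (k <= #|A|)%N -> exists2 B : {set T}, B \subset A & #|B| = k.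
Proof.
move=> kA; exists [set x in take k (enum A)].
  by apply/subsetP => x; rewrite inE => /mem_take; rewrite mem_enum.
rewrite cardsE; have /card_uniqP -> : uniq (take k (enum A)).
  by rewrite take_uniq // enum_uniq.
by rewrite size_take_min -cardE; apply/minn_idPl.
Qed.

(** The set [A v] consists of the indices [i < d] of the states with value [true]
    at [v].  A new leaf [v] has at most one neighbour [u] among the vertices
    already treated, and one picks [x v u] elements of [A v] inside [A u] and the
    others outside; the bounds on [x] say that there is enough room. *)
Lemma acyclic_sets_exist n (G : sgraph n) d (m : 'I_n -> nat) (x : 'I_n -> 'I_n -> nat) :
  is_acyclic G -> (forall v, m v <= d)%N -> (forall u v, x u v = x v u) ->
  (forall u v, G u v -> m u + m v - d <= x u v <= minn (m u) (m v))%N ->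
  exists A : 'I_n -> {set 'I_d},
    (forall v, #|A v| = m v) /\ (forall u v, G u v -> #|A u :&: A v| = x u v).
Proof.
move=> acyc md xC xP.
pose P (U : {set 'I_n}) := exists A : 'I_n -> {set 'I_d},
  {in U, forall v, #|A v| = m v} /\ {in U &, forall u v, G u v -> #|A u :&: A v| = x u v}.
suff [A [Am Ax]] : P setT.
  by exists A; split=> [v|u v uv]; rewrite ?Am ?Ax ?inE.
apply: (acyclic_ind acyc); first by exists (fun=> set0); split=> v; rewrite inE.
move=> U v vU leafv [A [Am Ax]].
have [B [Bm Bx]] : exists B : {set 'I_d},
    #|B| = m v /\ {in U, forall u, G v u -> #|B :&: A u| = x v u}.
  case: (pickP [pred u in U | G v u]) => [u /andP [uU vu]|no].
    have := xP _ _ vu; rewrite -(Am _ uU) => /andP [lo hi].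
    have cAu := cardsC (A u); rewrite card_ord in cAu.
    have [|B1 B1A B1x] := @exists_subset_card _ (A u) (x v u); first by lia.
    have [|B2 B2A B2x] := @exists_subset_card _ (~: A u) (m v - x v u); first by lia.
    have B2A0 : B2 :&: A u = set0.
      by apply/eqP; rewrite setI_eq0 disjoints_subset.
    exists (B1 :|: B2); split.
      have := cardsUI B1 B2; rewrite [B1 :&: B2](_ : _ = set0) ?cards0; first by lia.
      by apply/eqP; rewrite -subset0 -B2A0 setIC setIS.
    move=> w wU vw; rewrite -(leafv u w uU wU vu vw) setIUl B2A0 setU0.
    by rewrite (setIidPl B1A).
  have [|B _ Bm] := @exists_subset_card _ [set: 'I_d] (m v).
    by rewrite cardsT card_ord.
  exists B; split=> // u uU vu; by have := no u; rewrite /= uU vu.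
exists (fun w => if w == v then B else A w); split.
  by move=> w; rewrite in_setU1; case: eqP => [->|_] //= /Am.
move=> u w; rewrite !in_setU1; case: eqP => [->|_] /=; case: eqP => [->|_] //=.
- by rewrite adj_irr.
- by move=> _; apply: Bx.
- by move=> uU _; rewrite adj_sym => vu; rewrite setIC xC; apply: Bx.
- exact: Ax.
Qed.

(** * The fibers of the parametrization *)

Section Fibers.
Variables (n : nat) (G : sgraph n).
Notation state := {ffun 'I_n -> bool}.

Definition state_mnm (s : state) : 'X_{1..#|param G|} :=
  ((\sum_(e : {e : 'I_n * 'I_n | e \in edges G})
      U_(enum_rank (inl (e, (s (val e).1, s (val e).2)) : param G)))
  + \sum_(l : {l : 'I_n | l \in isolated G})
      U_(enum_rank (inr (l, s (val l)) : param G)))%MM.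

Lemma phi_varE (F : fieldType) s : phi_var F G s = 'X_[state_mnm s].
Proof. by rewrite mpolyXD -!mprodXE. Qed.

Definition image_mnm (M : 'X_{1..#|{: state}|}) : 'X_{1..#|param G|} :=
  (\sum_i (state_mnm (enum_val i) *+ M i))%MM.

Lemma phiX (F : fieldType) M : phi G ('X_[M] : {mpoly F[#|{: state}|]}) = 'X_[image_mnm M].
Proof.
rewrite /phi comp_mpolyX -mprodXnE; apply: eq_bigr => i _.
by rewrite tnth_mktuple phi_varE.
Qed.

(** The monomial [M] is seen as the multiset of its states. *)
Definition count_states (M : 'X_{1..#|{: state}|}) (q : pred state) : nat :=
  (\sum_s q s * M (enum_rank s))%N.

Lemma count_statesID M q r : count_states M q =
  (count_states M (fun s => q s && r s) + count_states M (fun s => q s && ~~ r s))%N.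
Proof.
rewrite -big_split; apply: eq_bigr => s _ /=.
by rewrite -mulnDl; congr (_ * _)%N; case: (q s); case: (r s).
Qed.

Lemma count_statesT M : count_states M predT = mdeg M.
Proof.
rewrite mdegE (reindex (@enum_rank state)) /=.
  by apply: eq_bigr => s _; rewrite mul1n.
by exists enum_val => i _; rewrite ?enum_rankK ?enum_valK.
Qed.

Lemma eq_count_states M q r : q =1 r -> count_states M q = count_states M r.
Proof. by move=> qr; apply: eq_bigr => s _; rewrite qr. Qed.

Lemma count_states_le M q : (count_states M q <= mdeg M)%N.
Proof. by rewrite -count_statesT; apply: leq_sum => s _; rewrite leq_mul2r leq_b1 orbT. Qed.

Lemma state_mnm_edge s e a b :
  state_mnm s (enum_rank (inl (e, (a, b)) : param G))
    = (s (val e).1 == a) && (s (val e).2 == b) :> nat.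
Proof.
rewrite mnmDE !mnm_sumE [X in (_ + X)%N]big1 => [|l _]; last first.
  by rewrite mnm1E (inj_eq enum_rank_inj).
rewrite addn0 (bigD1 e) //= big1 ?addn0 => [|e' ne]; last first.
  by rewrite mnm1E (inj_eq enum_rank_inj) eqE /= xpair_eqE (negbTE ne).
by rewrite mnm1E (inj_eq enum_rank_inj) eqE /= !xpair_eqE eqxx.
Qed.

Lemma state_mnm_isolated s l a :
  state_mnm s (enum_rank (inr (l, a) : param G)) = (s (val l) == a) :> nat.
Proof.
rewrite mnmDE !mnm_sumE [X in (X + _)%N]big1 => [|e _]; last first.
  by rewrite mnm1E (inj_eq enum_rank_inj).
rewrite add0n (bigD1 l) //= big1 ?addn0 => [|l' ne]; last first.
  by rewrite mnm1E (inj_eq enum_rank_inj) eqE /= xpair_eqE (negbTE ne).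
by rewrite mnm1E (inj_eq enum_rank_inj) eqE /= !xpair_eqE eqxx.
Qed.

Lemma image_mnmE M x :
  image_mnm M (enum_rank x) = (\sum_s state_mnm s (enum_rank x) * M (enum_rank s))%N.
Proof.
rewrite mnm_sumE (reindex (@enum_rank state)) /=.
  by apply: eq_bigr => s _; rewrite mulmnE enum_rankK.
by exists enum_val => i _; rewrite ?enum_rankK ?enum_valK.
Qed.

Lemma image_mnm_edge M e a b :
  image_mnm M (enum_rank (inl (e, (a, b)) : param G))
    = count_states M (fun s => (if a then s (val e).1 else ~~ s (val e).1)
                               && (if b then s (val e).2 else ~~ s (val e).2)).
Proof.
rewrite image_mnmE; apply: eq_bigr => s _; rewrite state_mnm_edge.
by case: a b => -[]; rewrite ?eqb_id ?eqbF_neg.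
Qed.

Lemma image_mnm_isolated M l a :
  image_mnm M (enum_rank (inr (l, a) : param G))
    = count_states M (fun s => if a then s (val l) else ~~ s (val l)).
Proof.
rewrite image_mnmE; apply: eq_bigr => s _; rewrite state_mnm_isolated.
by case: a; rewrite ?eqb_id ?eqbF_neg.
Qed.

Definition table_family_of (d : nat) (M : 'X_{1..#|{: state}|}) :
    {ffun 'I_n -> 'I_d.+1} * {ffun 'I_n * 'I_n -> 'I_d.+1} :=
  ([ffun v => inord (count_states M (fun s => s v))],
   [ffun e => if e \in edges G then inord (count_states M (fun s => s e.1 && s e.2))
              else ord0]).

(** With the margins and the total, one corner entry determines the table. *)
Lemma count_states_edge M (e : 'I_n * 'I_n) :
  [/\ count_states M (fun s => s e.1) =
        count_states M (fun s => s e.1 && s e.2) + count_states M (fun s => s e.1 && ~~ s e.2),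
      count_states M (fun s => s e.2) =
        count_states M (fun s => s e.1 && s e.2) + count_states M (fun s => ~~ s e.1 && s e.2)
    & mdeg M = count_states M (fun s => s e.1) +
        (count_states M (fun s => ~~ s e.1 && s e.2) +
         count_states M (fun s => ~~ s e.1 && ~~ s e.2))]%N.
Proof.
rewrite -count_statesT; split.
- rewrite (count_statesID M _ (fun s => s e.2)).
  by congr (_ + _)%N; apply: eq_count_states => s /=; rewrite ?inE andbC.
- rewrite (count_statesID M _ (fun s => s e.1)).
  by congr (_ + _)%N; apply: eq_count_states => s /=; rewrite ?inE andbC // andbC.
- rewrite (count_statesID M predT (fun s => s e.1)); congr (_ + _)%N.
  rewrite (count_statesID M _ (fun s => s e.2)).
  by congr (_ + _)%N; apply: eq_count_states => s /=; rewrite ?inE andbT // andbC.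
Qed.

(** The exponents of the image are the entries of the tables on the edges and the
    margins at the isolated vertices; every other vertex lies on an edge, whose
    table gives its margin. *)
Lemma image_mnm_eq_table_family d M M' : mdeg M = d -> mdeg M' = d ->
  image_mnm M = image_mnm M' <-> table_family_of d M = table_family_of d M'.
Proof.
move=> Md M'd.
have inordE q : (inord (count_states M q) = inord (count_states M' q) :> 'I_d.+1) <->
    count_states M q = count_states M' q.
  split=> [/(congr1 val)|->//].
  by rewrite /= !inordK // ltnS ?(leq_trans (count_states_le _ _)) ?Md ?M'd.
split=> [eqM|[/ffunP eqm /ffunP eqx]].
  have eqMx x : image_mnm M (enum_rank x) = image_mnm M' (enum_rank x) by rewrite eqM.
  have cE (e : 'I_n * 'I_n) : e \in edges G ->
     [/\ count_states M (fun s => s e.1 && s e.2) = count_states M' (fun s => s e.1 && s e.2),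
         count_states M (fun s => s e.1 && ~~ s e.2) = count_states M' (fun s => s e.1 && ~~ s e.2)
       & count_states M (fun s => ~~ s e.1 && s e.2) =
           count_states M' (fun s => ~~ s e.1 && s e.2)].
    move=> eG; pose e' : {e : 'I_n * 'I_n | e \in edges G} := exist _ e eG.
    have edgeE a b := eqMx (inl (e', (a, b)) : param G).
    have := edgeE true true; have := edgeE true false; have := edgeE false true.
    by rewrite !image_mnm_edge.
  congr (_, _); apply/ffunP => v; rewrite !ffunE; last first.
    by case: ifP => // vG; apply/inordE; case: (cE v vG).
  apply/inordE; case: (boolP (v \in isolated G)) => [vi|].
    by have := eqMx (inr (exist _ v vi, true) : param G); rewrite !image_mnm_isolated.
  rewrite inE negb_forall => /existsP [w]; rewrite negbK => vw.
  have [vltw|wltv|/val_inj vew] := ltngtP v w.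
  - have eG : (v, w) \in edges G by rewrite inE vltw.
    have [/= -> _ _] := count_states_edge M (v, w); have [/= -> _ _] := count_states_edge M' (v, w).
    by case: (cE _ eG) => /= -> ->.
  - have eG : (w, v) \in edges G by rewrite inE wltv adj_sym.
    have [/= _ -> _] := count_states_edge M (w, v); have [/= _ -> _] := count_states_edge M' (w, v).
    by case: (cE _ eG) => /= -> _ ->.
  - by rewrite vew adj_irr in vw.
have mE v : count_states M (fun s => s v) = count_states M' (fun s => s v).
  by apply/inordE; have := eqm v; rewrite !ffunE.
apply/mnmP => i; rewrite -(enum_valK i); case: (enum_val i) => [[e [a b]]|[l a]].
  rewrite !image_mnm_edge.
  have [] := count_states_edge M (val e); have [] := count_states_edge M' (val e).
  have := mE (val e).1; have := mE (val e).2.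
  have /inordE : inord (count_states M (fun s => s (val e).1 && s (val e).2)) =
     inord (count_states M' (fun s => s (val e).1 && s (val e).2)) :> 'I_d.+1.
    by have := eqx (val e); rewrite !ffunE (valP e).
  by rewrite Md M'd; case: a b => -[] /=; lia.
rewrite !image_mnm_isolated; case: a => //=.
have /= := count_statesID M predT (fun s => s (val l)).
have /= := count_statesID M' predT (fun s => s (val l)).
by rewrite !count_statesT Md M'd mE; lia.
Qed.

Lemma table_family_of_in d M : mdeg M = d -> table_family_of d M \in table_families (edges G) d.
Proof.
move=> Md; rewrite inE; apply/pfamilyP; split.
  by apply/supportP => e /negbTE eG; rewrite ffunE eG.
move=> e eG; rewrite !inE !ffunE eG !inordK ?ltnS -?Md ?count_states_le //.
have [E1 E2 E3] := count_states_edge M e; rewrite {}E3 {}E2 {}E1 leq_min.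
set a := count_states _ _; set b := count_states _ _.
by set c := count_states _ _; set z := count_states _ _; lia.
Qed.

Lemma table_family_of_onto d t : is_acyclic G -> t \in table_families (edges G) d ->
  exists2 M, mdeg M = d & table_family_of d M = t.
Proof.
case: t => m x acyc; rewrite inE => /pfamilyP /= [/supportP x0 xP].
pose y (u v : 'I_n) : nat := if (u < v)%N then x (u, v) else x (v, u).
have [||u v|A [Am Ax]] := @acyclic_sets_exist n G d (fun v => m v) y acyc.
- by move=> v; rewrite -ltnS.
- by move=> u v; rewrite /y; case: ltngtP => // /val_inj ->.
- move=> uv; rewrite /y; case: ltngtP => [ultv|vltu|/val_inj uev].
  + by have := xP (u, v); rewrite !inE /= ultv => /(_ uv).
  + have := xP (v, u); rewrite !inE /= vltu adj_sym => /(_ uv).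
    by rewrite addnC minnC.
  + by rewrite uev adj_irr in uv.
pose st (i : 'I_d) : state := [ffun v => i \in A v].
pose M : 'X_{1..#|{: state}|} := [multinom #|[set i | st i == enum_val k]| | k < #|{: state}|].
have cM q : count_states M q = #|[set i | q (st i)]|.
  rewrite -sum1dep_card (partition_big st predT) //=; apply: eq_bigr => s _.
  rewrite mnmE enum_rankK -sum1dep_card big_distrr /= big_mkcond [RHS]big_mkcond /=.
  by apply: eq_bigr => i _; case: eqP => [->|]; rewrite ?andbF ?andbT //; case: (q s).
have Md : mdeg M = d.
  by rewrite -count_statesT cM -[RHS]card_ord -cardsT; apply: eq_card => i; rewrite !inE.
exists M => //; congr (_, _); apply/ffunP => v; rewrite ffunE.
  apply: val_inj; rewrite cM /= inordK.
    by rewrite -[RHS]Am; apply: eq_card => i; rewrite !inE ffunE.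
  by rewrite ltnS -[leqRHS]card_ord max_card.
case: ifP => vG; last by rewrite (x0 _ (negbT vG)).
apply: val_inj; rewrite cM /= inordK; last first.
  by rewrite ltnS -[leqRHS]card_ord max_card.
move: (vG); rewrite inE => /andP [vlt vadj].
transitivity (y v.1 v.2); last by rewrite /y vlt -surjective_pairing.
by rewrite -Ax //; apply: eq_card => i; rewrite !inE !ffunE.
Qed.

Lemma hilbert_fun_toric (F : fieldType) d : is_acyclic G ->
  hilbert_fun_is (toric_ideal F G) d (table_sum (edges G) d).
Proof.
move=> acyc; rewrite -card_table_families.
apply: (@hilbert_fun_card F _ _ (comp_mpoly [tuple phi_var F G (enum_val i) | i < #|{: state}|])
          image_mnm _ _ _ (table_family_of d)).
- exact: phiX.
- exact: image_mnm_eq_table_family.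
- exact: table_family_of_in.
- by move=> t; apply: table_family_of_onto.
Qed.

Lemma hilbert_fun_toric_inj (F : fieldType) d h h' :
  hilbert_fun_is (toric_ideal F G) d h -> hilbert_fun_is (toric_ideal F G) d h' -> h = h'.
Proof.
exact: (@hilbert_fun_inj F _ _ (comp_mpoly [tuple phi_var F G (enum_val i) | i < #|{: state}|])).
Qed.
End Fibers.

(** * Sums and products of polynomial functions *)

(** Summing the binomial expansion of [(i+1)^(k+1) - i^(k+1)] over [i < m]
    telescopes on the left and expresses the power sum of exponent [k] by those of
    lower exponents. *)
Lemma sum_pow_poly k :
  exists q : {poly rat}, forall m : nat, q.[m%:R] = \sum_(i < m) i%:R ^+ k.
Proof.
suff [Q QP] : exists Q : nat -> {poly rat},
    forall j, (j < k.+1)%N -> forall m : nat, (Q j).[m%:R] = \sum_(i < m) i%:R ^+ j.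
  by exists (Q k); apply: QP.
elim: k.+1 => [|{}k [Q QP]]; first by exists (fun=> 0).
pose q := (k.+1%:R^-1)%:P * ('X^(k.+1) - \sum_(j < k) 'C(k.+1, j)%:R%:P * Q j).
exists (fun j => if j == k then q else Q j) => j; rewrite ltnS leq_eqVlt.
case: eqP => [-> _|_ /= jk]; last exact: QP.
move=> m; rewrite /q !hornerE horner_sum; apply: (mulfI (x := k.+1%:R)).
  by rewrite pnatr_eq0.
rewrite mulrA mulfV ?pnatr_eq0 // mul1r; apply/eqP; rewrite subr_eq; apply/eqP.
transitivity (\sum_(i < m) ((i.+1%:R : rat) ^+ k.+1 - i%:R ^+ k.+1)).
  rewrite -(big_mkord xpredT (fun i => i.+1%:R ^+ k.+1 - i%:R ^+ k.+1)).
  by rewrite ?telescope_sumr // expr0n subr0.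
rewrite mulr_sumr; under [X in _ + X]eq_bigr do rewrite !hornerE QP // mulr_sumr.
rewrite exchange_big -big_split; apply: eq_bigr => i _ /=.
rewrite -nat1r exprDn !big_ord_recr /= !subnn !expr1n !mul1r binn mulr1n addrK.
rewrite binSn addrC mulr_natl; congr (_ + _).
by apply: eq_bigr => l _; rewrite expr1n mul1r mulr_natl.
Qed.

Lemma horner2E (P : {poly {poly rat}}) (x y : rat) (a : {poly rat}) :
  a.[x] = y -> P.[a].[x] = P.[y%:P].[x].
Proof.
move=> axy; have H b : P.[b].[x] = (map_poly (horner_eval x) P).[b.[x]].
  by rewrite -[b.[x]]/(horner_eval x b) horner_map.
by rewrite !H axy hornerC.
Qed.

Local Notation eval2 P d m := (P.[m%:R].[d%:R]).

Lemma sum_poly2 (P : {poly {poly rat}}) :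
  exists Q : {poly {poly rat}}, forall d m : nat,
    eval2 Q d m = \sum_(i < m) eval2 P d i.
Proof.
have [q qP] := choice sum_pow_poly.
exists (\sum_(k < size P) P`_k *: map_poly polyC (q k)) => d m.
rewrite !horner_sum; under [RHS]eq_bigr do rewrite (horner_coef P) horner_sum.
rewrite exchange_big; apply: eq_bigr => k _ /=.
rewrite hornerZ hornerM.
rewrite -[m%:R in X in _ * X](rmorph_nat polyC) horner_map hornerC qP mulr_sumr.
by apply: eq_bigr => i _; rewrite hornerM horner_exp -(rmorph_nat polyC) hornerC.
Qed.

Definition poly2 (f : nat -> nat -> rat) : Prop :=
  exists P : {poly {poly rat}}, forall d m, (m <= d)%N -> f d m = eval2 P d m.

Lemma poly2_1 : poly2 (fun _ _ => 1).
Proof. by exists 1 => d m _; rewrite !hornerE. Qed.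

Lemma poly2M f g : poly2 f -> poly2 g -> poly2 (fun d m => f d m * g d m).
Proof.
by move=> [P fP] [Q gQ]; exists (P * Q) => d m md; rewrite fP // gQ // !hornerM.
Qed.

Lemma poly2_rev f : poly2 f -> poly2 (fun d m => f d (d - m)%N).
Proof.
move=> [P fP]; exists (P \Po ('X%:P - 'X)) => d m md.
rewrite fP ?leq_subr // horner_comp [RHS](@horner2E _ _ (d - m)%:R) ?(rmorph_nat polyC) //.
by rewrite -(rmorph_nat polyC m) !hornerE natrB.
Qed.

Lemma sum_poly2_row f : poly2 f ->
  exists p : {poly rat}, forall d : nat, \sum_(i < d.+1) f d i = p.[d%:R].
Proof.
move=> [P fP]; have [Q QP] := sum_poly2 P.
(* The upper bound [d+1] of the sum is itself substituted as a polynomial in [d]. *)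
exists (Q.['X + 1]) => d.
rewrite (@horner2E _ _ d.+1%:R) ?hornerE ?natr1 // (rmorph_nat polyC) QP.
by apply: eq_bigr => i _; rewrite fP // -ltnS.
Qed.

(** This form separates the roles of [i] and [d - i], each entering through a
    minimum with [m]. *)
Lemma num_tablesE d m i : (m <= d)%N -> (i <= d)%N ->
  (num_tables d m i)%:R = 1 - m%:R + (minn m i)%:R + (minn m (d - i))%:R :> rat.
Proof.
move=> md id_; have : (num_tables d m i + m = 1 + minn m i + minn m (d - i))%N.
  by rewrite /num_tables; lia.
by move/(congr1 (fun k : nat => k%:R : rat)); rewrite !natrD => E; lra.
Qed.

Lemma num_tablesC d a b : num_tables d a b = num_tables d b a.
Proof. by rewrite /num_tables minnC addnC. Qed.

Lemma card_ord_lt m i : #|[pred j : 'I_m | (j < i)%N]| = minn m i.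
Proof.
rewrite -sum1_card big_mkcond /=; elim: m => [|m IHm]; first by rewrite big_ord0 min0n.
by rewrite big_ord_recr /= {}IHm unfold_in /=; case: ltnP; lia.
Qed.

(** Since [min(m, i)] counts the [j < m] with [j < i], the sum is an indefinite sum
    over [j] of the tails of the sum of [f d]. *)
Lemma poly2_sum_min f : poly2 f ->
  poly2 (fun d m => \sum_(i < d.+1) (minn m i)%:R * f d i).
Proof.
move=> f_poly; have [P fP] := f_poly.
have [p pP] := sum_poly2_row f_poly; have [S SP] := sum_poly2 P.
have [SS SSP] := sum_poly2 (S \Po ('X + 1)).
exists ('X * p%:P - SS) => d m md.
have Sj j : (j <= d)%N -> \sum_(i < d.+1 | (j < i)%N) f d i = p.[d%:R] - eval2 S d j.+1.
  move=> jd; rewrite -pP SP [in RHS](bigID (fun i : 'I_d.+1 => (j < i)%N)) /=.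
  rewrite -addrA [X in _ + X](_ : _ = 0) ?addr0 //; apply/eqP; rewrite subr_eq0; apply/eqP.
  rewrite [RHS](big_ord_widen d.+1 (fun i => eval2 P d i)) //.
  apply: eq_big => [i|i _]; first by rewrite -leqNgt ltnS.
  by rewrite fP // -ltnS.
rewrite -(rmorph_nat polyC m) !hornerE rmorph_nat SSP.
transitivity (\sum_(j < m) \sum_(i < d.+1 | (j < i)%N) f d i).
  rewrite (exchange_big_dep predT) //=; apply: eq_bigr => i _.
  rewrite sumr_const mulr_natl; congr (_ *+ _).
  exact/esym/card_ord_lt.
under eq_bigr => j _ do rewrite Sj ?(leq_trans (ltnW (ltn_ord j))) //.
rewrite sumrB sumr_const card_ord mulr_natl; congr (_ - _).
apply: eq_bigr => j _; rewrite horner_comp !hornerE.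
by rewrite natr1.
Qed.

(** The sum over the value at a leaf, as a function of the value at its
    neighbour. *)
Lemma poly2_tables f : poly2 f ->
  poly2 (fun d m => \sum_(i < d.+1) (num_tables d m i)%:R * f d i).
Proof.
move=> f_poly; have [p pP] := sum_poly2_row f_poly.
have [Q QP] := poly2_sum_min f_poly; have [Q' Q'P] := poly2_sum_min (poly2_rev f_poly).
exists ((1 - 'X) * p%:P + Q + Q') => d m md.
under eq_bigr => i _ do rewrite (num_tablesE md (leq_ord i)) 2!mulrDl.
rewrite !big_split /= -mulr_sumr pP QP //.
have -> : \sum_(i < d.+1) (minn m (d - i))%:R * f d i = eval2 Q' d m.
  rewrite -Q'P // (reindex_inj rev_ord_inj) /=; apply: eq_bigr => i _.
  by rewrite subSS (subKn (leq_ord i)).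
by rewrite -(rmorph_nat polyC m) !hornerE rmorph_nat.
Qed.

(** * Polynomiality of the table sum of a forest *)

Section Elimination.
Variables (n : nat) (G : sgraph n) (d : nat).

Definition inner_edges (U : {set 'I_n}) : {set 'I_n * 'I_n} :=
  [set e in edges G | (e.1 \in U) && (e.2 \in U)].

Definition weight (w : 'I_n -> nat -> nat -> rat) (U : {set 'I_n})
    (m : {ffun 'I_n -> 'I_d.+1}) : rat :=
  \prod_(v in U) w v d (m v) * \prod_(e in inner_edges U) (num_tables d (m e.1) (m e.2))%:R.

(** The coordinates outside [U] are set to [0], so that sums for different [U]
    range over the same type and extending [U] by [v] frees one coordinate. *)
Definition weight_sum w (U : {set 'I_n}) : rat :=
  \sum_(m : {ffun 'I_n -> 'I_d.+1} | [forall v, (v \notin U) ==> (m v == ord0)]) weight w U m.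

Definition ffun_upd (m : {ffun 'I_n -> 'I_d.+1}) v a : {ffun 'I_n -> 'I_d.+1} :=
  [ffun u => if u == v then a else m u].

Lemma sum_ffun_upd (U : {set 'I_n}) v (f : {ffun 'I_n -> 'I_d.+1} -> rat) : v \notin U ->
  \sum_(m : {ffun 'I_n -> 'I_d.+1} | [forall u, (u \notin v |: U) ==> (m u == ord0)]) f m =
  \sum_(m : {ffun 'I_n -> 'I_d.+1} | [forall u, (u \notin U) ==> (m u == ord0)])
     \sum_(a < d.+1) f (ffun_upd m v a).
Proof.
move=> vU; rewrite pair_big /=.
rewrite (reindex_onto (fun ma : {ffun 'I_n -> 'I_d.+1} * 'I_d.+1 => ffun_upd ma.1 v ma.2)
           (fun m => (ffun_upd m v ord0, m v))) /=; last first.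
  by move=> m _; apply/ffunP => u; rewrite !ffunE; case: eqP => [->|].
apply: eq_bigl => -[m a] /=; rewrite andbT; apply/andP/forallP => [[/forallP m0 /eqP [mv _]] u|m0].
  apply/implyP => uU; case: (eqVneq u v) => [->|uv].
    by rewrite -mv ffunE eqxx.
  by have := m0 u; rewrite !inE negb_or uv uU ffunE (negbTE uv).
split.
  apply/forallP => u; apply/implyP; rewrite !inE negb_or ffunE => /andP [/negbTE -> uU].
  exact: (implyP (m0 u)).
rewrite xpair_eqE ffunE !eqxx andbT; apply/eqP/ffunP => u; rewrite !ffunE.
by case: (eqVneq u v) => [->|//]; have /eqP -> := implyP (m0 v) vU.
Qed.

(** The new vertex [v] contributes the factor of its edge to [U], if there is
    one. *)
Lemma prod_inner_edges (U : {set 'I_n}) v (g : 'I_n -> 'I_n -> rat) : v \notin U ->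
  (forall a b, g a b = g b a) ->
  {in U &, forall a b, G v a -> G v b -> a = b} ->
  \prod_(e in inner_edges (v |: U)) g e.1 e.2 =
  (if [pick u in U | G v u] is Some u then g v u else 1) *
  \prod_(e in inner_edges U) g e.1 e.2.
Proof.
move=> vU gC leafv.
rewrite (bigID (fun e => (e.1 == v) || (e.2 == v))) /=; congr (_ * _); last first.
  apply: eq_bigl => -[a b]; rewrite !inE /= !negb_or -!andbA; congr (_ && (_ && _)).
  case: (eqVneq a v) => [->|_]; first by rewrite (negbTE vU) andbF.
  case: (eqVneq b v) => [->|_]; first by rewrite (negbTE vU) !andbF.
  by rewrite andbT.
case: pickP => [u /= /andP [uU vu]|no]; last first.
  rewrite big_pred0 // => -[a b]; rewrite !inE /=; apply/negbTE/negP.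
  case/andP=> [/andP [/andP [_ ab] /andP [aU bU]] /orP [] /eqP ev]; subst.
    case/predU1P: bU => [bv|bU]; first by rewrite bv adj_irr in ab.
    by have := no b; rewrite /= bU ab.
  case/predU1P: aU => [av|aU]; first by rewrite av adj_irr in ab.
  by have := no a; rewrite /= aU adj_sym ab.
have uv : u != v by apply: contraTneq uU => ->.
(* Edges are stored with increasing endpoints. *)
rewrite (big_pred1 (if (u < v)%N then (u, v) else (v, u))) => [|[a b] /=].
  by case: ifP.
rewrite !inE /=; apply/idP/eqP => [|ab].
  case/andP=> [/andP [/andP [lab ab] /andP [aU bU]] /orP [] /eqP ev]; subst.
    case/predU1P: bU => [bv|bU]; first by rewrite bv adj_irr in ab.
    by rewrite (leafv u b) // ltnNge (ltnW lab).
  case/predU1P: aU => [av|aU]; first by rewrite av adj_irr in ab.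
  by rewrite adj_sym in ab; rewrite (leafv u a) // lab.
case: ltngtP ab => [luv|luv|/val_inj euv] [-> ->].
- by rewrite luv adj_sym vu uU !eqxx orbT.
- by rewrite luv vu uU !eqxx orbT.
- by rewrite euv eqxx in uv.
Qed.
End Elimination.

(** Summing out a leaf [v] with neighbour [u] multiplies the weight at [u] by the
    transform of [poly2_tables] of the weight at [v]; this is why arbitrary
    polynomial weights are carried through the induction. *)
Lemma weight_sum_poly n (G : sgraph n) (w : 'I_n -> nat -> nat -> rat) :
  is_acyclic G -> (forall v, poly2 (w v)) ->
  exists p : {poly rat}, forall d : nat, weight_sum G d w setT = p.[d%:R].
Proof.
move=> acyc.
pose P (U : {set 'I_n}) := forall w : 'I_n -> nat -> nat -> rat, (forall v, poly2 (w v)) ->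
  exists p : {poly rat}, forall d : nat, weight_sum G d w U = p.[d%:R].
move: w; apply: (acyclic_ind (P := P) acyc) => [w _|U v vU leafv IH w wpoly].
  exists 1 => d; rewrite hornerE /weight_sum (big_pred1 [ffun=> ord0]) => [|m /=].
    by rewrite /weight !big1 ?mul1r // => e; rewrite !inE ?andbF.
  apply/forallP/eqP => [m0|-> u]; last by rewrite ffunE eqxx implybT.
  by apply/ffunP => u; rewrite ffunE; have := m0 u; rewrite inE => /eqP.
pose nb := [pick u in U | G v u].
have step d : weight_sum G d w (v |: U) =
   \sum_(m : {ffun 'I_n -> 'I_d.+1} | [forall v, (v \notin U) ==> (m v == ord0)])
     weight G w U m * \sum_(a < d.+1)
       (if nb is Some u then (num_tables d (m u) a)%:R else 1) * w v d a.
  rewrite /weight_sum sum_ffun_upd //; apply: eq_bigr => m _.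
  rewrite mulr_sumr; apply: eq_bigr => a _.
  rewrite /weight big_setU1 //= ffunE eqxx.
  rewrite (prod_inner_edges (g := fun x y =>
    (num_tables d (ffun_upd m v a x) (ffun_upd m v a y))%:R)) //; last first.
    by move=> x y; rewrite num_tablesC.
  have updE u : u \in U -> ffun_upd m v a u = m u.
    by rewrite ffunE; case: eqP => // -> /(negP vU).
  rewrite (eq_bigr (fun u => w u d (m u))) => [|u uU]; last by rewrite updE.
  rewrite (eq_bigr (fun e : 'I_n * 'I_n => (num_tables d (m e.1) (m e.2))%:R)) => [|e]; last first.
    by rewrite inE => /and3P [_ e1 e2]; rewrite !updE.
  rewrite /nb; case: pickP => [u /= /andP [uU _]|_]; last by rewrite !mul1r; ring.
  by rewrite (updE u uU) /ffun_upd ffunE eqxx num_tablesC; ring.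
rewrite /nb in step *; case: pickP step => [u /= /andP [uU vu]|no] step.
  pose w' x := if x == u then fun d m => w u d m * \sum_(a < d.+1) (num_tables d m a)%:R * w v d a
               else w x.
  have [|p pP] := IH w'.
    move=> x; rewrite /w'; case: eqP => // _.
    exact: poly2M (wpoly u) (poly2_tables (wpoly v)).
  exists p => d; rewrite step -pP; apply: eq_bigr => m _.
  rewrite /weight (bigD1 u) //= [in RHS](bigD1 u) //= /w' eqxx.
  rewrite [in RHS](eq_bigr (fun x => w x d (m x))) => [|x /andP [_ /negbTE ->] //].
  ring.
have [p pP] := IH w wpoly; have [q qP] := sum_poly2_row (wpoly v).
exists (p * q) => d; rewrite step hornerM -pP -qP mulr_suml.
by apply: eq_bigr => m _; congr (_ * _); apply: eq_bigr => a _; rewrite mul1r.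
Qed.

Lemma table_sum_poly n (G : sgraph n) : is_acyclic G ->
  exists p : {poly rat}, forall d : nat, (table_sum (edges G) d)%:R = p.[d%:R].
Proof.
move=> acyc; have [p pP] := weight_sum_poly acyc (fun=> poly2_1).
exists p => d; rewrite -pP natr_sum; apply: eq_big => [m|m _].
  by apply/esym/forallP => v; rewrite inE.
rewrite /weight natr_prod [X in _ = X * _]big1 // mul1r; apply: eq_bigl => e.
by rewrite [RHS]in_set !in_setT /= andbT.
Qed.

(** * The degree of a polynomial from its growth *)

Lemma horner_nat_bound (p : {poly rat}) k : (size p <= k.+1)%N ->
  exists C : rat, forall x : nat, (0 < x)%N -> `|p.[x%:R]| <= C * x%:R ^+ k.
Proof.
move=> sp; exists (\sum_(i < size p) `|p`_i|) => x x0.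
rewrite horner_coef (le_trans (ler_norm_sum _ _ _)) // mulr_suml.
apply: ler_sum => i _; rewrite normrM normrX (ger0_norm (ler0n _ _)).
apply: ler_wpM2l => //; apply: ler_weXn2l; first by rewrite ler1n.
by rewrite -ltnS (leq_trans (ltn_ord i)).
Qed.

Lemma nat_unbounded (c C : rat) (x0 : nat) : 0 < c -> exists2 x : nat, (x0 < x)%N & C < c * x%:R.
Proof.
move=> c0; exists (x0.+1 + Num.bound (`|C| / c))%N; first by rewrite ltn_addr.
apply: le_lt_trans (ler_norm _) _; rewrite mulrC -ltr_pdivrMr //.
apply: lt_le_trans (archi_boundP _) _; first by rewrite divr_ge0 // ltW.
by rewrite ler_nat leq_addl.
Qed.

(** A polynomial of degree [s+1 > k] satisfies
    [`|c| x^(s+1) <= (`|B| + C) x^s] for its leading coefficient [c], which fails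
    for large [x]. *)
Lemma size_le_horner_nat (p : {poly rat}) k B (x0 : nat) :
  (forall x : nat, (x0 <= x)%N -> `|p.[x%:R]| <= B * x%:R ^+ k) -> (size p <= k.+1)%N.
Proof.
move=> pB; rewrite leqNgt; apply/negP => sp.
case def_s: (size p) sp => [//|[//|s]] ks.
have p0 : p != 0 by rewrite -size_poly_gt0 def_s.
pose c := lead_coef p; have c0 : c != 0 by rewrite lead_coef_eq0.
have [C CP] : exists C : rat, forall x : nat, (0 < x)%N ->
    `|(p - c *: 'X^(s.+1)).[x%:R]| <= C * x%:R ^+ s.
  apply: horner_nat_bound; apply/leq_sizeP => j; rewrite leq_eqVlt.
  rewrite coefB coefZ coefXn => /predU1P [<-|sj].
    by rewrite eqxx mulr1 /c lead_coefE def_s subrr.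
  by rewrite nth_default ?def_s // gtn_eqF ?mulr0 ?subrr.
have c_gt0 : 0 < `|c| by rewrite normr_gt0.
have [x x0x] := nat_unbounded (`|B| + C) x0 c_gt0.
rewrite ltNge => /negP; apply.
have x1 : (0 < x)%N by apply: leq_ltn_trans x0x.
have xs : 0 < x%:R ^+ s :> rat by rewrite exprn_gt0 // ltr0n.
rewrite -(ler_pM2r xs) -mulrA -exprS mulrDl.
have -> : `|c| * x%:R ^+ s.+1 = `|p.[x%:R] - (p - c *: 'X^(s.+1)).[x%:R]|.
  by rewrite !hornerE opprB addrC subrK normrM normrX (ger0_norm (ler0n _ _)).
apply: le_trans (ler_normB _ _) _; apply: lerD; last exact: CP.
apply: le_trans (pB _ (ltnW x0x)) _; apply: (@le_trans _ _ (`|B| * x%:R ^+ k)).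
  by rewrite ler_wpM2r ?ler_norm // exprn_ge0.
by apply: ler_wpM2l => //; apply: ler_weXn2l => //; rewrite ler1n.
Qed.

Lemma size_gt_horner_nat (p : {poly rat}) k (a : nat) : (0 < a)%N ->
  (forall q : nat, q%:R ^+ k <= p.[(a * q)%:R]) -> (k < size p)%N.
Proof.
move=> a0 pq; rewrite ltnNge; apply/negP; case: k pq => [|k] pq sp.
  by have := pq 0%N; move: sp; rewrite size_poly_leq0 => /eqP ->; rewrite horner0 expr0 ler10.
have [C CP] := horner_nat_bound sp.
have [q q0] := nat_unbounded (C * a%:R ^+ k) 0 (c := 1) ltr01.
rewrite mul1r ltNge => /negP; apply.
have qk : 0 < q%:R ^+ k :> rat by rewrite exprn_gt0 // ltr0n.
rewrite -(ler_pM2r qk) -exprS -mulrA -exprMn -natrM.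
apply: le_trans (pq q) _; apply: le_trans (ler_norm _) _.
by apply: CP; rewrite muln_gt0 a0.
Qed.

Lemma horner_nat_eq0 (p : {poly rat}) (x0 : nat) :
  (forall x : nat, (x0 <= x)%N -> p.[x%:R] = 0) -> p = 0.
Proof.
move=> p0; have sp : (size p <= 1)%N.
  by apply: (@size_le_horner_nat _ 0 0 x0) => x /p0 ->; rewrite normr0 mul0r.
by have := p0 x0 (leqnn _); rewrite (size1_polyC sp) hornerC => ->.
Qed.

(** * The degree of the Hilbert polynomial *)

Lemma table_sum_le n (E : {set 'I_n * 'I_n}) d :
  (table_sum E d <= d.+1 ^ (n + #|E|))%N.
Proof.
rewrite expnD -[X in (_ ^ X * _)%N](card_ord n) -{1}(card_ord d.+1) -card_ffun -sum_nat_const.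
apply: leq_sum => m _; rewrite -prod_nat_const; apply: leq_prod => e _.
by have := leq_ord (m e.1); rewrite /num_tables; lia.
Qed.

(** When both margins lie in the middle third of [[0, 3q]], there are at least [q]
    tables. *)
Lemma table_sum_ge n (E : {set 'I_n * 'I_n}) q :
  (q ^ (n + #|E|) <= table_sum E (3 * q))%N.
Proof.
pose mid := [pred x : 'I_(3 * q).+1 | (q <= x <= 2 * q)%N].
have cmid : (q <= #|mid|)%N by rewrite card_ord_itv; lia.
apply: (@leq_trans (#|ffun_on mid : {pred {ffun 'I_n -> 'I_(3 * q).+1}}| * q ^ #|E|)%N).
  rewrite card_ffun_on card_ord expnD leq_mul2r; apply/orP; right.
  by case: (n) => // k; rewrite leq_exp2r.
rewrite -sum_nat_const /table_sum [leqRHS](bigID (mem (ffun_on mid))) /=.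
apply: leq_trans (leq_addr _ _); apply: leq_sum => m /ffun_onP mP.
rewrite -prod_nat_const; apply: leq_prod => e _.
have /andP [a1 a2] : (q <= m e.1 <= 2 * q)%N := mP e.1.
have /andP [b1 b2] : (q <= m e.2 <= 2 * q)%N := mP e.2.
move: a1 a2 b1 b2; rewrite /num_tables.
move: (nat_of_ord (m e.1)) (nat_of_ord (m e.2)) => a b. lia.
Qed.

Lemma size_table_sum_poly n (E : {set 'I_n * 'I_n}) (p : {poly rat}) :
  (forall d : nat, (table_sum E d)%:R = p.[d%:R]) -> size p = (n + #|E|).+1.
Proof.
move=> pP; apply/eqP; rewrite eqn_leq; apply/andP; split.
  apply: (@size_le_horner_nat _ _ (2 ^+ (n + #|E|)) 1) => d d1.
  rewrite -pP ger0_norm ?ler0n // -exprMn -natrM -natrX ler_nat.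
  apply: leq_trans (table_sum_le _ _) _.
  by case: (n + #|E|)%N => // k; rewrite leq_exp2r //; lia.
apply: (@size_gt_horner_nat _ _ 3) => // q.
by rewrite -pP -natrX ler_nat table_sum_ge.
Qed.

(** * Shifting the tables by a diagonal *)

Lemma num_tables_gt0 d a b : (a <= d)%N -> (b <= d)%N -> (0 < num_tables d a b)%N.
Proof. by rewrite /num_tables; lia. Qed.

(** The assignments [m] with all values in [[1, d+1]] are the shifts by one of those
    for [d].  The others take the value [0] or [d+2] at some vertex; an edge
    through it carries a single table and contributes the factor [0]. *)
Lemma table_sum_shift n (E : {set 'I_n * 'I_n}) d :
  (forall v, exists2 e, e \in E & (v == e.1) || (v == e.2)) ->
  (\sum_(m : {ffun 'I_n -> 'I_d.+3}) \prod_(e in E) (num_tables d.+2 (m e.1) (m e.2)).-1)%N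
   = table_sum E d.
Proof.
move=> cover.
pose sh (m : {ffun 'I_n -> 'I_d.+1}) : {ffun 'I_n -> 'I_d.+3} := [ffun v => inord (m v).+1].
have shE m v : sh m v = (m v).+1 :> nat.
  by rewrite ffunE inordK // !ltnS ltnW.
have sh_inj : injective sh.
  move=> m m' /ffunP eqm; apply/ffunP => v; apply: val_inj.
  by have := congr1 val (eqm v); rewrite /= !shE => -[].
rewrite (bigID (mem (sh @: setT))) /= [X in (_ + X)%N]big1 ?addn0 => [|m msh].
  rewrite big_imset; last by move=> ? ? _ _; apply: sh_inj.
  apply: eq_big => [m|m _]; first by rewrite inE.
  apply: eq_bigr => e _; rewrite !shE /num_tables.
  have := leq_ord (m e.1); have := leq_ord (m e.2).
  by move: (nat_of_ord (m e.1)) (nat_of_ord (m e.2)) => a b; lia.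
have [v mv] : exists v, (m v == 0 :> nat) || (m v == d.+2 :> nat).
  apply/existsP; apply: contraR msh; rewrite negb_exists => /forallP mP.
  apply/imsetP; exists [ffun v => inord (m v).-1] => //.
  apply/ffunP => v; apply: val_inj; rewrite /= shE ffunE.
  have mv : (0 < m v <= d.+1)%N.
    by move: (mP v) (ltn_ord (m v)); move: (nat_of_ord (m v)) => a; lia.
  by rewrite inordK; move: (nat_of_ord (m v)) mv => a; lia.
have [e eE ve] := cover v; rewrite (bigD1 e) //=.
have := leq_ord (m e.1); have := leq_ord (m e.2).
suff -> : (num_tables d.+2 (m e.1) (m e.2)).-1 = 0%N by rewrite mul0n.
rewrite /num_tables; case/orP: ve mv => /eqP <-.
  by have := leq_ord (m e.2); lia.
by have := leq_ord (m e.1); lia.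
Qed.

Lemma prodr_sub1_powerset (R : comNzRingType) (I : finType) (E : {set I}) (f : I -> R) :
  \prod_(i in E) (f i - 1) =
  \sum_(S in powerset E) (-1) ^+ #|S| * \prod_(i in E :\: S) f i.
Proof.
rewrite big_mkcond /= (eq_bigr (fun i => (if i \in E then - 1 else 0) +
   (if i \in E then f i else 1))) => [|i _]; last first.
  by case: ifP; rewrite ?add0r // addrC.
rewrite bigA_distr /= [LHS](bigID (mem (powerset E))) /= [X in _ + X]big1 ?addr0 => [|S].
  apply: eq_big => // S; rewrite powersetE => SE.
  rewrite (bigID (mem S)) /=; congr (_ * _).
    by rewrite -prodr_const; apply: eq_bigr => i iS; rewrite iS (subsetP SE).
  rewrite (eq_bigr (fun i => if i \in E then f i else 1)) => [|i /negbTE -> //].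
  by rewrite -big_mkcondr; apply: eq_bigl => i; rewrite inE.
rewrite powersetE => /subsetPn [i iS iE].
by rewrite (bigD1 i) //= iS (negbTE iE) mul0r.
Qed.

Lemma table_sum_inclusion_exclusion n (E : {set 'I_n * 'I_n}) d :
  (forall v, exists2 e, e \in E & (v == e.1) || (v == e.2)) ->
  (table_sum E d)%:R =
  \sum_(S in powerset E) (-1) ^+ #|S| * (table_sum (E :\: S) d.+2)%:R :> rat.
Proof.
move=> cover; rewrite -table_sum_shift // natr_sum.
under [RHS]eq_bigr do rewrite natr_sum mulr_sumr.
rewrite [RHS]exchange_big; apply: eq_bigr => m _ /=.
under [RHS]eq_bigr do rewrite natr_prod.
rewrite -prodr_sub1_powerset natr_prod; apply: eq_bigr => e _.
have := num_tables_gt0 (leq_ord (m e.1)) (leq_ord (m e.2)).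
by case: (num_tables _ _ _) => // k _; rewrite -natr1 addrK.
Qed.

Lemma sum_powerset_split (V : zmodType) (I : finType) (E : {set I}) (F : {set I} -> V) :
  \sum_(S in powerset E) F S =
  F set0 + \sum_(e in E) F [set e] + \sum_(S in powerset E | (1 < #|S|)%N) F S.
Proof.
rewrite (bigID (fun S : {set I} => (1 < #|S|)%N)) /= addrC; congr (_ + _).
rewrite (bigD1 set0) ?powersetE ?sub0set ?cards0 //=; congr (_ + _).
rewrite -(big_imset F (in2W (@set1_inj I))) /=; apply: eq_bigl => S.
rewrite powersetE -leqNgt; apply/idP/imsetP => [|[e eE ->]]; last first.
  by rewrite sub1set eE cards1 /= -card_gt0 cards1.
case/andP=> [/andP [SE S1] S0].
have /cards1P [e Se] : #|S| == 1%N by rewrite eqn_leq S1 card_gt0.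
by exists e; rewrite // -sub1set -Se.
Qed.

Lemma coef_exp_XsubC (R : comNzRingType) (c : R) s :
  (('X - c%:P) ^+ s.+1)`_s = - (c *+ s.+1).
Proof.
elim: s => [|s IHs]; first by rewrite expr1 coefB coefX coefC /= sub0r.
rewrite exprS mulrBl coefB coefXM coefCM /= IHs.
have := monic_exp s.+1 (monicXsubC c); rewrite monicE lead_coefE size_exp_XsubC /= => /eqP ->.
by rewrite mulr1 -opprD -mulrSr.
Qed.

Lemma coef_comp_XsubC (R : comNzRingType) (p : {poly R}) (c : R) s :
  (size p <= s.+2)%N ->
  (p \Po ('X - c%:P))`_s = p`_s - p`_s.+1 * c *+ s.+1.
Proof.
move=> sp; rewrite coef_comp_poly.
rewrite (big_ord_widen s.+2 (fun i => p`_i * (('X - c%:P) ^+ i)`_s)) //.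
rewrite big_mkcond !big_ord_recr /= big1 ?add0r => [|i _]; last first.
  by case: ifP => // _; rewrite [X in _ * X]nth_default ?mulr0 // size_exp_XsubC.
rewrite coef_exp_XsubC.
have -> : (('X - c%:P) ^+ s)`_s = 1.
  have := monic_exp s (monicXsubC c).
  by rewrite monicE lead_coefE size_exp_XsubC => /eqP.
rewrite mulr1 mulrN -mulrnAr.
by congr (_ + _); case: ltnP => // ps; rewrite nth_default ?mul0r ?oppr0.
Qed.

(** The polynomial [D] takes at [d+2] the value of the terms with [#|S| >= 2] of the
    inclusion-exclusion, so it has degree at most [k = n + #|E| - 2]; the identity
    says that its coefficient of index [k+1] vanishes. *)
Lemma lead_coef_table_sum n (E : {set 'I_n * 'I_n}) (p : {poly rat})
    (q : 'I_n * 'I_n -> {poly rat}) :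
  (0 < n)%N ->
  (forall v, exists2 e, e \in E & (v == e.1) || (v == e.2)) ->
  (forall d : nat, (table_sum E d)%:R = p.[d%:R]) ->
  (forall e, e \in E -> forall d : nat, (table_sum (E :\ e) d)%:R = (q e).[d%:R]) ->
  \sum_(e in E) lead_coef (q e) = 2 * (n + #|E|)%:R * lead_coef p.
Proof.
move=> n0 cover pP qP.
have E0 : (0 < #|E|)%N.
  by have [e eE _] := cover (Ordinal n0); rewrite card_gt0; apply/set0Pn; exists e.
have sp := size_table_sum_poly pP.
have sq e : e \in E -> size (q e) = (n + #|E|)%N.
  move=> eE; rewrite (size_table_sum_poly (qP e eE)) (cardsD1 e E) eE.
  by rewrite add1n addnS.
have [k kE] : exists k, (n + #|E| = k.+2)%N by exists (n + #|E| - 2)%N; lia.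
pose D := p \Po ('X - 2%:P) - p + \sum_(e in E) q e.
have sD : (size D <= k.+1)%N.
  apply: (@size_le_horner_nat _ _ (#|powerset E|%:R * 2 ^+ k) 2) => -[//|[//|d]] _.
  have -> : D.[d.+2%:R] = \sum_(S in powerset E | (1 < #|S|)%N)
      (-1) ^+ #|S| * (table_sum (E :\: S) d.+2)%:R.
    have := table_sum_inclusion_exclusion d cover.
    rewrite sum_powerset_split cards0 expr0 mul1r setD0 !pP => Ed.
    rewrite !hornerE horner_comp !hornerE horner_sum.
    have -> : d.+2%:R - (1 + 1) = d%:R :> rat by rewrite -addn2 natrD addrK.
    rewrite {}Ed (eq_bigr (fun e => - (q e).[d.+2%:R])) => [|e eE].
      by rewrite sumrN; ring.
    by rewrite cards1 expr1 mulN1r qP.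
  apply: le_trans (ler_norm_sum _ _ _) _.
  rewrite -mulrA -exprMn -natrM -natrX -sum1_card natr_sum mulr_suml.
  rewrite big_mkcondr /=; apply: ler_sum => S.
  rewrite powersetE => SE; case: ifP => [S2|_]; last by rewrite mul1r ler0n.
  rewrite mul1r normrM normrX normrN1 expr1n mul1r ger0_norm ?ler0n // ler_nat.
  apply: leq_trans (table_sum_le _ _) _.
  apply: (@leq_trans (d.+3 ^ k)%N).
    rewrite leq_exp2l // cardsD (setIidPr SE).
    by move: (subset_leq_card SE) kE S2; move: (#|E|) (#|S|) => a b; lia.
  by case: k {kE} => // k; rewrite leq_exp2r //; lia.
have /eqP : D`_k.+1 = 0 by rewrite nth_default.
rewrite /D coefD coefB coef_comp_XsubC ?sp ?kE // coef_sum.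
rewrite (eq_bigr (fun e => lead_coef (q e))) => [|e eE]; last first.
  by rewrite lead_coefE sq // kE.
rewrite [lead_coef p]lead_coefE sp kE /= => /eqP D0.
apply/eqP; rewrite -subr_eq0 -[X in _ == X]D0; apply/eqP.
by rewrite -[_ *+ k.+2]mulr_natl; ring.
Qed.

(** * Deleting an edge of a tree *)

Lemma edges_del_edge n (G : sgraph n) e :
  e \in edges G -> edges (del_edge G e) = edges G :\ e.
Proof.
case: e => a b; rewrite inE /= => /andP [ab _]; apply/setP => -[x y].
rewrite !inE /= /del_adj /= !xpair_eqE.
case: (ltnP x y) => [xy|_]; rewrite ?andbF //=.
case: (boolP ((y == a) && (x == b))) => [/andP [/eqP ya /eqP xb]|_].
  by rewrite ya xb ltnNge (ltnW ab) in xy.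
by rewrite andbT andbC.
Qed.

Lemma acyclic_del_edge n (G : sgraph n) e : is_acyclic G -> is_acyclic (del_edge G e).
Proof.
move=> acyc c c2 /andP [cyc uc]; apply: (acyc c c2); apply/andP; split=> //.
by apply: sub_cycle cyc => x y /= /and3P [].
Qed.

Lemma connected_cover n (G : sgraph n) : (1 < n)%N -> is_connected G ->
  forall v, exists2 e, e \in edges G & (v == e.1) || (v == e.2).
Proof.
move=> n1 [n0 conn] v.
have [w vw] : exists w : 'I_n, v != w.
  apply/existsP; apply: contraLR n1; rewrite negb_exists -leqNgt => /forallP vall.
  rewrite -[X in (X <= _)%N]card_ord; apply/card_le1P => x _ y.
  have /eqP <- := negbNE (vall x); have /eqP <- := negbNE (vall y).
  by rewrite !inE eqxx.
have /connectP [[|u s] /=] := conn v w; first by move=> _ wv; rewrite wv eqxx in vw.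
case/andP=> vu _ _; case: (ltngtP v u) => [lvu|luv|/val_inj uv].
- by exists (v, u); rewrite ?inE /= ?lvu ?eqxx.
- by exists (u, v); rewrite ?inE /= ?luv ?eqxx ?orbT // adj_sym.
- by rewrite uv adj_irr in vu.
Qed.

(** A polynomial is determined by its values at large naturals, so the chosen
    Hilbert polynomial is [p]. *)
Lemma ideal_degree_toric n (G : sgraph n) (F : fieldType) (p : {poly rat}) :
  is_acyclic G -> (forall d : nat, (table_sum (edges G) d)%:R = p.[d%:R]) ->
  ideal_degree (toric_ideal F G) = lead_coef p * (n + #|edges G|)`!%:R.
Proof.
move=> acyc pP; suff hp : hilbert_poly (toric_ideal F G) = p.
  by rewrite /ideal_degree hp (size_table_sum_poly pP).
have pH : is_hilbert_poly (toric_ideal F G) p.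
  exists 0%N => d _; exists (table_sum (edges G) d); last by rewrite pP.
  exact: hilbert_fun_toric.
have [d0 hP] : is_hilbert_poly (toric_ideal F G) (hilbert_poly (toric_ideal F G)).
  exact: (classical_sets.xgetPex (P := fun p => is_hilbert_poly _ p) 0 (ex_intro _ p pH)).
apply/eqP; rewrite -subr_eq0; apply/eqP; apply: (@horner_nat_eq0 _ d0) => d d0d.
have [h hd hE] := hP d d0d.
by rewrite hornerD hornerN hE (hilbert_fun_toric_inj hd (hilbert_fun_toric F d acyc)) pP subrr.
Qed.

Theorem theorem5p5 (R : realType) (n : nat) (G : sgraph n) :
  (1 < n)%N -> is_tree G ->
  ideal_degree (toric_ideal R[i] G) =
    2^-1 * \sum_(e in edges G) ideal_degree (toric_ideal R[i] (del_edge G e)).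
Proof.
move=> n1 [conn acyc].
have acycD e := acyclic_del_edge (e := e) acyc.
have [p pP] := table_sum_poly acyc.
have [q qP] := choice (fun e => table_sum_poly (acycD e)).
have cover := connected_cover n1 conn.
have lead := lead_coef_table_sum (q := q) (ltnW n1) cover pP.
rewrite (ideal_degree_toric _ acyc pP).
under eq_bigr => e eE do rewrite (ideal_degree_toric _ (acycD e) (qP e)).
have [k kE] : exists k, (n + #|edges G| = k.+1)%N by exists (n + #|edges G|).-1; lia.
rewrite (eq_bigr (fun e => lead_coef (q e) * k`!%:R)) => [|e eE]; last first.
  move: kE; rewrite edges_del_edge // (cardsD1 e (edges G)) eE addnCA add1n => -[<-] //.
rewrite -mulr_suml lead => [|e eE d]; last by rewrite -edges_del_edge.
by rewrite kE factS natrM -!mulrA; field.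
Qed.
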